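(* Let $(X,J)$ be the compact almost-complex manifold described in the context. Then $h^{1,0}_{\mathrm{Dol}}=1$ (spanned by $\Phi^1$), $h^{2,0}_{\mathrm{Dol}}=0$, $h^{3,0}_{\mathrm{Dol}}=0$.
   Context: General notions. For an almost-complex manifold $(X,J)$, $A^k(X)=\bigoplus_{p+q=k}A^{p,q}(X)$ and $d=\mu+\partial+\overline{\partial}+\bar\mu$ with $\mu:A^{p,q}\to A^{p+2,q-1}$, $\partial:A^{p,q}\to A^{p+1,q}$, $\overline{\partial}:A^{p,q}\to A^{p,q+1}$, $\bar\mu:A^{p,q}\to A^{p-1,q+2}$. The almost-complex Dolbeault cohomology (of Cirici–Wilson) in bidegree $(p,0)$ is $H^{p,0}_{\mathrm{Dol}}(X)=\{\psi\in A^{p,0}(X):\overline{\partial}\psi=0,\ \bar\mu\psi=0\}$, and $h^{p,0}_{\mathrm{Dol}}$ is its complex dimension. The manifold. Let $G$ be the Lie group $\mathbb{R}^2\ltimes_\Phi\mathbb{R}^4$ with coordinates $(t,x,y_1,y_2,z_1,z_2)$ and product $(t,x,y_1,y_2,z_1,z_2)*(t',x',y_1',y_2',z_1',z_2')=(t+t',x+x',y_1'e^t+xz_1'e^t+y_1,\,y_2'e^{-t}+xz_2'e^{-t}+y_2,\,z_1'e^t+z_1,\,z_2'e^{-t}+z_2)$. Let $B\in SL(2,\mathbb{Z})$ have distinct eigenvalues $e^{a_0},e^{-a_0}$ ($a_0>0$) and $P$ real invertible with $PBP^{-1}=\mathrm{diag}(e^{a_0},e^{-a_0})$. Let $\Gamma$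 be the lattice of elements with $t\in a_0\mathbb{Z}$, $x\in\mathbb{Z}$, $(y_1,y_2)=(m_1,m_2)P^t$, $(z_1,z_2)=(n_1,n_2)P^t$, $m_i,n_i\in\mathbb{Z}$, and $X=\Gamma\backslash G$. Left-invariant $1$-forms: $e^1=dt$, $e^2=dx$, $e^3=e^{-t}dy_1-xe^{-t}dz_1$, $e^4=e^{t}dy_2-xe^{t}dz_2$, $e^5=e^{-t}dz_1$, $e^6=e^tdz_2$, with $de^1=de^2=0$, $de^3=-e^{13}-e^{25}$, $de^4=e^{14}-e^{26}$, $de^5=-e^{15}$, $de^6=e^{16}$. The structure. $J$ is the almost-complex structure on $X$ whose $(1,0)$-forms are spanned by $\Phi^1=e^1+ie^2$, $\Phi^2=e^3+ie^4$, $\Phi^3=e^5+ie^6$. *)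

(* Defs.v *)
From HB Require Import structures.
From mathcomp Require Import all_boot all_order all_algebra.
From mathcomp Require Import all_classical all_reals all_analysis.
From mathcomp Require Import complex.

Set Implicit Arguments.
Unset Strict Implicit.
Unset Printing Implicit Defensive.

Import Order.TTheory GRing.Theory Num.Theory.
Import numFieldNormedType.Exports.
Local Open Scope ring_scope.

(* The Lie group G = R^2 |x_Phi R^4, coordinates g = (t,x,y1,y2,z1,z2)      *)
(* stored as a row vector g : 'rV[R]_6, g 0 0 = t, g 0 1 = x, g 0 2 = y1,   *)
(* g 0 3 = y2, g 0 4 = z1, g 0 5 = z2.                                      *)
Section Manifold.
Variable R : realType.

Local Notation pt := (matrix R 1 6).

Definition mk6 (a b c d e f : R) : pt :=
  \row_(i < 6) nth 0 [:: a; b; c; d; e; f] i.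

Definition crd (g : pt) (k : nat) : R := g 0 (inord k).

Definition Gmul (g h : pt) : pt :=
  let t := crd g 0 in let x := crd g 1 in
  mk6 (t + crd h 0) (x + crd h 1)
      (crd h 2 * expR t + x * crd h 4 * expR t + crd g 2)
      (crd h 3 * expR (- t) + x * crd h 5 * expR (- t) + crd g 3)
      (crd h 4 * expR t + crd g 4)
      (crd h 5 * expR (- t) + crd g 5).

Definition inGamma (a0 : R) (P : 'M[R]_2) (g : pt) : Prop :=
  exists (k xi m1 m2 n1 n2 : int),
    crd g 0 = k%:~R * a0 /\ crd g 1 = xi%:~R /\
    [/\ crd g 2 = m1%:~R * P 0 0 + m2%:~R * P 0 1,
        crd g 3 = m1%:~R * P 1 0 + m2%:~R * P 1 1,
        crd g 4 = n1%:~R * P 0 0 + n2%:~R * P 0 1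
      & crd g 5 = n1%:~R * P 1 0 + n2%:~R * P 1 1].

Local Notation C := R[i].

Definition rC (r : R) : C := Complex r 0.
Definition iC : C := Complex 0 1.

Definition unitv (k : 'I_6) : pt := delta_mx 0 k.

Definition pdR (k : 'I_6) (h : pt -> R) : pt -> R := fun g => 'D_(unitv k) h g.

Definition smoothR (h : pt -> R) : Prop :=
  forall l : seq 'I_6,
    continuous (foldr pdR h l) /\
    forall (k : 'I_6) (g : pt), derivable (foldr pdR h l) g (unitv k).

Definition smoothC (f : pt -> C) : Prop :=
  smoothR (fun g => complex.Re (f g)) /\ smoothR (fun g => complex.Im (f g)).

Definition pd (k : 'I_6) (f : pt -> C) : pt -> C := fun g =>
  Complex (pdR k (fun g' => complex.Re (f g')) g)
          (pdR k (fun g' => complex.Im (f g')) g).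

(* Complex differential forms on G, written in the global left-invariant   *)
(* complex coframe theta_0..theta_5 :=                                      *)
(*     Phi^1, Phi^2, Phi^3, conj(Phi^1), conj(Phi^2), conj(Phi^3).          *)
(* A form w is given by its coefficients: w S is the coefficient of         *)
(* theta_S = theta_{s_1} /\ ... /\ theta_{s_k}  (s_1 < ... < s_k, S={s_i}). *)
Definition form := {set 'I_6} -> pt -> C.

Definition fzero : form := fun _ _ => 0.
Definition fadd (a b : form) : form := fun S g => a S g + b S g.
Definition fsub (a b : form) : form := fun S g => a S g - b S g.
Definition fscale (c : C) (a : form) : form := fun S g => c * a S g.
Definition fmulf (f : pt -> C) (a : form) : form := fun S g => f g * a S g.

Definition basis (S : {set 'I_6}) : form := fun U _ => (U == S)%:R.

(* sign of theta_S /\ theta_T = wsign S T * theta_(S :|: T) *)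
Definition wsign (S T : {set 'I_6}) : C :=
  if [disjoint S & T] then
    (-1) ^+ #|[set p : 'I_6 * 'I_6 | [&& p.1 \in S, p.2 \in T & (p.2 < p.1)%N]]|
  else 0.

Definition wedge (a b : form) : form := fun U g =>
  \sum_(S : {set 'I_6}) \sum_(T : {set 'I_6} | S :|: T == U)
     wsign S T * a S g * b T g.

Definition Phi (j : nat) : form := basis [set (inord j : 'I_6)].       (* Phi^(j+1) *)
Definition Phibar (j : nat) : form := basis [set (inord (j + 3) : 'I_6)].

(* the real left-invariant coframe e^1..e^6 in terms of theta:
   e^(2j+1) = (Phi^(j+1) + conj Phi^(j+1)) / 2,
   e^(2j+2) = (Phi^(j+1) - conj Phi^(j+1)) / (2 i)                     *)
Definition ef (k : nat) : form :=
  let j := (k.-1)./2 in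
  if odd k then fscale (rC 2^-1) (fadd (Phi j) (Phibar j))
  else fscale (2 * iC)^-1 (fsub (Phi j) (Phibar j)).

Definition e2 (a b : nat) : form := wedge (ef a) (ef b).

Definition de (k : nat) : form :=
  match k with
  | 3 => fsub (fscale (-1) (e2 1 3)) (e2 2 5)
  | 4 => fsub (e2 1 4) (e2 2 6)
  | 5 => fscale (-1) (e2 1 5)
  | 6 => e2 1 6
  | _ => fzero
  end.

Definition dtheta (s : 'I_6) : form :=
  if (s < 3)%N then fadd (de (2 * s).+1) (fscale iC (de (2 * s).+2))
  else fsub (de (2 * (s - 3)).+1) (fscale iC (de (2 * (s - 3)).+2)).

(* d theta_S (Leibniz rule; the 2-forms d theta_s are even) *)
Definition dbasis (S : {set 'I_6}) : form := fun U g =>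
  \sum_(s in S)
    (-1) ^+ #|[set u in S | (u < s)%N]| * wedge (dtheta s) (basis (S :\ s)) U g.

(* coordinate differentials dt, dx, dy1, dy2, dz1, dz2 in the coframe e^k:
   dt = e^1, dx = e^2, dy1 = e^t e^3 + x e^t e^5, dy2 = e^-t e^4 + x e^-t e^6,
   dz1 = e^t e^5, dz2 = e^-t e^6 (inverting the definition of the e^k) *)
Definition dcoord (c : 'I_6) : form := fun U g =>
  let t := crd g 0 in let x := crd g 1 in
  match val c with
  | 0 => ef 1 U g
  | 1 => ef 2 U g
  | 2 => rC (expR t) * ef 3 U g + rC (x * expR t) * ef 5 U g
  | 3 => rC (expR (- t)) * ef 4 U g + rC (x * expR (- t)) * ef 6 U g
  | 4 => rC (expR t) * ef 5 U g
  | _ => rC (expR (- t)) * ef 6 U g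
  end.

Definition dfun (f : pt -> C) : form := fun U g =>
  \sum_(c < 6) pd c f g * dcoord c U g.

Definition dform (w : form) : form := fun U g =>
  \sum_(S : {set 'I_6})
     (wedge (dfun (w S)) (basis S) U g + w S g * dbasis S U g).

Definition nhol (U : {set 'I_6}) : nat := #|[set u in U | (u < 3)%N]|.
Definition nanti (U : {set 'I_6}) : nat := #|[set u in U | (3 <= u)%N]|.

Definition is_type (p q : nat) (w : form) : Prop :=
  forall U g, ~~ ((nhol U == p) && (nanti U == q)) -> w U g = 0.

Definition proj (r s : nat) (w : form) : form := fun U g =>
  if (nhol U == r) && (nanti U == s) then w U g else 0.

(* for w of type (p,q): dbar w = (p,q+1)-part of dw, mubar w = (p-1,q+2)-part *)
Definition dbar (p q : nat) (w : form) : form := proj p q.+1 (dform w).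
Definition mubar (p q : nat) (w : form) : form := fun U g =>
  if (nhol U).+1 == p then proj (nhol U) q.+2 (dform w) U g else 0.

(* smooth forms on X = Gamma \ G: smooth coefficients (w.r.t. the
   left-invariant frame) that are invariant under left translation by Gamma *)
Definition smooth_form_X (a0 : R) (P : 'M[R]_2) (w : form) : Prop :=
  forall S, smoothC (w S) /\
    forall gam g, inGamma a0 P gam -> w S (Gmul gam g) = w S g.

Definition form_eq0 (w : form) : Prop := forall U g, w U g = 0.

Definition HDol_p0 (a0 : R) (P : 'M[R]_2) (p : nat) (psi : form) : Prop :=
  [/\ smooth_form_X a0 P psi, is_type p 0 psi,
      form_eq0 (dbar p 0 psi) & form_eq0 (mubar p 0 psi)].

End Manifold.

(* Main.v *)
Require Import Defs.
From HB Require Import structures.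
From mathcomp Require Import all_boot all_order all_algebra.
From mathcomp Require Import all_classical all_reals all_analysis.
From mathcomp Require Import complex ring lra.
Import Order.TTheory GRing.Theory Num.Theory.
Import numFieldNormedType.Exports.
Local Open Scope ring_scope.

(* The equation [mubar psi = 0] is algebraic: since [d Phi^2] and [d Phi^3] have the
    (0,2)-components [-1/2 conj(Phi^1 Phi^2)] and [-1/2 conj(Phi^1 Phi^3)], it kills every
    coefficient of [psi] whose index set meets [Phi^2] or [Phi^3].  Hence [psi = 0] for
    [p >= 2] and [psi = f Phi^1] for [p = 1], where [dbar psi = 0] says that [f] is
    annihilated by the conjugates of the dual frame.  The bracket of [conj Z_1] with
    [conj Z_2] (resp. [conj Z_3], modulo [conj Z_2]) shows that [f] is also annihilated by
    [Z_2] (resp. [Z_3]), so [f] does not depend on [y_1, y_2, z_1, z_2].  On the slice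
    [y = z = 0] it is a holomorphic function of [t + i x], periodic in [t] and in [x],
    hence constant. *)

Set Implicit Arguments.
Unset Strict Implicit.
Unset Printing Implicit Defensive.

(** * Calculus in one and two real variables *)

Lemma is_derive_continuous (R : realType) (f df : R -> R) :
  (forall x, is_derive x (1:R) f (df x)) -> continuous f.
Proof.
by move=> d x; apply/differentiable_continuous/derivable1_diffP; apply: ex_derive.
Qed.

Lemma MVT_global (R : realType) (f df : R -> R) (a b : R) : a < b ->
  (forall x, is_derive x (1:R) f (df x)) ->
  exists2 c, a < c < b & f b - f a = df c * (b - a).
Proof.
move=> ab d.
have [] := @MVT R f df a b ab (fun x _ => d x).
  by apply: continuous_subspaceT; exact: is_derive_continuous d.
by move=> c; rewrite in_itv /= => cab e; exists c.
Qed.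

Lemma derive0_constant (R : realType) (f : R -> R) :
  (forall x, is_derive x (1:R) f 0) -> forall x y, f x = f y.
Proof.
move=> d x y; wlog xy : x y / x < y => [H|].
  by have [/H|/H|->] := ltgtP x y.
have [c _] := MVT_global xy d.
by rewrite mul0r => /eqP; rewrite subr_eq0 => /eqP.
Qed.

(* The mixed second difference over a small rectangle is computed by the mean
   value theorem in both orders. *)
Lemma mixed_partials_eq (R : realType) (f fx fy fxy fyx : R -> R -> R) (a b : R) :
  (forall s r, is_derive s (1:R) (f ^~ r) (fx s r)) ->
  (forall s r, is_derive r (1:R) (f s) (fy s r)) ->
  (forall s r, is_derive r (1:R) (fx s) (fxy s r)) ->
  (forall s r, is_derive s (1:R) (fy ^~ r) (fyx s r)) ->
  {for (a, b), continuous (fun p : R * R => fxy p.1 p.2)} ->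
  {for (a, b), continuous (fun p : R * R => fyx p.1 p.2)} ->
  fxy a b = fyx a b.
Proof.
move=> dfx dfy dfxy dfyx cxy cyx.
have key h : 0 < h -> exists s r s' r', [/\ a < s < a + h, b < r < b + h,
    a < s' < a + h, b < r' < b + h & fxy s r = fyx s' r'].
  move=> h0.
  have ah : a < a + h by rewrite ltrDl.
  have bh : b < b + h by rewrite ltrDl.
  have [s sI es] := @MVT_global R (fun s => f s (b + h) - f s b)
    (fun s => fx s (b + h) - fx s b) _ _ ah (fun s => is_deriveB _ _).
  have [r rI er] := @MVT_global R (fx s) (fxy s) _ _ bh (dfxy s).
  have [r' r'I er'] := @MVT_global R (fun r => f (a + h) r - f a r)
    (fun r => fy (a + h) r - fy a r) _ _ bh (fun s => is_deriveB _ _).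
  have [s' s'I es'] := @MVT_global R (fy ^~ r') (fyx ^~ r') _ _ ah (fun s => dfyx s r').
  exists s, r, s', r'; split => //.
  have hh : h * h != 0 by rewrite mulf_neq0 ?gt_eqF.
  have e1 : (a + h) - a = h by ring.
  have e2 : (b + h) - b = h by ring.
  rewrite e1 e2 in es er es' er'.
  apply: (mulIf hh); rewrite !mulrA -er -es'/= -es -er'; ring.
(* Near [(a, b)] both mixed partials stay within [e / 2] of their values there, and [key] gives
   points of a small square at which they agree. *)
apply/eqP; rewrite -subr_eq0 -normr_le0; apply/ler_addgt0Pl => e e0; rewrite addr0.
have e20 : 0 < e / 2 by rewrite divr_gt0.
have /cvgrPdist_lt/(_ _ e20) nxy := cxy.
have /cvgrPdist_lt/(_ _ e20) nyx := cyx.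
have [d /= d0 dP] := (nbhs_ballP _ _).1 (filterI nxy nyx).
have [s [r [s' [r' [sI rI s'I r'I E]]]]] := key _ d0.
have inb s1 r1 : a < s1 < a + d -> b < r1 < b + d -> ball ((a, b) : R * R) d (s1, r1).
  move=> /andP[? ?] /andP[? ?]; split; rewrite /ball /= ltr_norml; apply/andP; split; lra.
have [/= H1 _] := dP _ (inb _ _ sI rI).
have [/= _ H2] := dP _ (inb _ _ s'I r'I).
have -> : fxy a b - fyx a b = (fxy a b - fxy s r) - (fyx a b - fyx s' r') by rewrite E; ring.
apply: (le_trans (ler_normB _ _)); rewrite [leRHS](splitr e).
by apply: lerD; exact: ltW.
Qed.

Lemma continuous_segment_integrable (R : realType) (f : R -> R) (a b : R) :
  continuous f ->
  (@lebesgue_measure R).-integrable `[a, b]%classic (EFin \o f).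
Proof.
move=> cf; apply: continuous_compact_integrable; first exact: segment_compact.
exact: continuous_subspaceT.
Qed.

(** The primitive of [h] from [c] lies between 0 and the total integral, so it vanishes on the open
    interval; its derivative at [m] is [h m]. *)
Lemma Rintegral_eq0_continuous (R : realType) (h : R -> R) (c d m : R) :
  continuous h -> (forall x, 0 <= h x) -> c < m < d ->
  \int[@lebesgue_measure R]_(x in `[c, d]%classic) h x = 0 -> h m = 0.
Proof.
move=> ch h0 /andP[cm md] I0.
pose G y := \int[@lebesgue_measure R]_(x in `[c, y]%classic) h x.
have ih a b := @continuous_segment_integrable R h a b ch.
have [dG G'] := continuous_FTC1_closed md (ih c d) cm (ch m).
rewrite -G' derive1E.
have G0 y : c < y < d -> G y = 0.
  move=> /andP[cy yd]; apply/eqP; rewrite eq_le; apply/andP; split; last first.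
    by rewrite /G; apply: Rintegral_ge0.
  rewrite -I0 -subr_ge0 /G Rintegral_itvB ?bnd_simp //; [|exact: ltW..].
  by apply: Rintegral_ge0.
suff : is_derive m (1:R) G 0 by move=> [].
apply: (@near_eq_is_derive _ _ _ (cst 0)).
near=> y; rewrite G0 //; apply/andP; split.
  by near: y; apply: lt_nbhsr.
by near: y; apply: lt_nbhsl.
Unshelve. all: by end_near. Qed.

Lemma continuous_prod_r (R : realType) (f : R * R -> R) (t : R) :
  continuous f -> continuous (fun x => f (t, x)).
Proof.
move=> cf x; apply: (@continuous_comp _ _ _ (fun x : R => (t, x)) f); last exact: cf.
exact: (@cvg_pair _ _ _ (nbhs x) (nbhs t) (nbhs x) _ _ _ (cst t) id (cvg_cst _) cvg_id).
Qed.

(** Supplies the dominating constant for differentiation under the integral sign. *)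
Lemma continuous_rectangle_bounded (R : realType) (f : R * R -> R) (a b c d : R) :
  continuous f -> exists2 M, 0 <= M &
    forall x y, a <= x <= b -> c <= y <= d -> `|f (x, y)| <= M.
Proof.
move=> cf.
have cK : compact (`[a, b]%classic `*` `[c, d]%classic)%classic.
  by apply: compact_setX; exact: segment_compact.
have [M [_ HM]] := compact_bounded (continuous_compact (continuous_subspaceT cf) cK).
(* Compactness only gives bounds strictly above [M], hence [M + 1]; the maximum makes the bound
   nonnegative. *)
exists (Num.max 0 (M + 1)); first by rewrite le_max lexx.
move=> x y xI yI; rewrite le_max; apply/orP; right.
apply: HM; first by rewrite ltrDl.
by exists (x, y) => //; split; rewrite /= in_itv.
Qed.

(** * Doubly periodic harmonic functions *)

Lemma periodic_derive (R : realType) (f df : R -> R) (q x : R) :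
  (forall x, is_derive x (1:R) f (df x)) -> (forall x, f (x + q) = f x) ->
  df (x + q) = df x.
Proof.
move=> d per.
have fq : f \o shift q = f by apply/funext => y /=; rewrite per.
have dfq : is_derive x (1:R) (f \o shift q) (df (x + q) * 1).
  by apply: is_derive1_comp; exact: is_derive_shift.
by rewrite fq mulr1 in dfq; have [_ <-] := dfq; have [_ ->] := d x.
Qed.

(* With [E t = \int u u_t dx] over a period, integration by parts gives
   [E' = \int (u_t ^ 2 + u_x ^ 2) dx >= 0], while [E] is periodic. *)
Lemma biperiodic_harmonic_constant (R : realType) (p q : R)
    (u ut ux utt uxx : R -> R -> R) :
  0 < p -> 0 < q ->
  (forall t x, u (t + p) x = u t x) -> (forall t x, u t (x + q) = u t x) ->
  (forall t x, is_derive t (1:R) (u ^~ x) (ut t x)) ->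
  (forall t x, is_derive x (1:R) (u t) (ux t x)) ->
  (forall t x, is_derive t (1:R) (ut ^~ x) (utt t x)) ->
  (forall t x, is_derive x (1:R) (ux t) (uxx t x)) ->
  continuous (fun z : R * R => u z.1 z.2) ->
  continuous (fun z : R * R => ut z.1 z.2) ->
  continuous (fun z : R * R => ux z.1 z.2) ->
  continuous (fun z : R * R => utt z.1 z.2) ->
  (forall t x, utt t x + uxx t x = 0) ->
  forall t x, ut t x = 0 /\ ux t x = 0.
Proof.
move=> p0 q0 up uq dt dx dtt dxx cu ct cx ctt lap t0 x0.
have utp t x : ut (t + p) x = ut t x.
  exact: (periodic_derive t (fun t => dt t x) (up ^~ x)).
have uxq t x : ux t (x + q) = ux t x by exact: (periodic_derive x (dx t) (uq t)).
(* The period interval is centred at [x0], so that [x0] is interior, as [Rintegral_eq0_continuous]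
   requires. *)
pose c := x0 - q / 2; pose d := c + q.
have cd : c < d by rewrite ltrDl.
pose F t x := u t x * ut t x.
pose F' t x := ut t x ^+ 2 + u t x * utt t x.
have dF t x : is_derive t (1:R) (F ^~ x) (F' t x).
  by apply: (is_derive_eq (is_deriveM (dt t x) (dtt t x))); rewrite /F' /GRing.scale /=; ring.
have cF : continuous (fun z : R * R => F z.1 z.2).
  by move=> z; apply: cvgM; [exact: cu|exact: ct].
have cF' : continuous (fun z : R * R => F' z.1 z.2).
  by move=> z; apply: cvgD; [apply: cvgM; exact: ct|apply: cvgM; [exact: cu|exact: ctt]].
pose mu := @lebesgue_measure R.
pose E t := \int[mu]_(x in `[c, d]%classic) F t x.
have cx' (f : R -> R -> R) : continuous (fun z : R * R => f z.1 z.2) ->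
    forall t, continuous (f t).
  by move=> cf t; exact: (continuous_prod_r (t := t) cf).
have dE t : is_derive t (1:R) E (\int[mu]_(x in `[c, d]%classic) F' t x).
  have [M M0 HM] := @continuous_rectangle_bounded R (fun z => F' z.1 z.2) (t - 1) (t + 1) c d cF'.
  have pE s x : partial1of2 F s x = F' s x.
    by rewrite partial1of2E; have [] := dF s x.
  have tI : `]t - 1, t + 1[%classic t by rewrite /= in_itv /=; apply/andP; split; lra.
  have intF (s : R) : `]t - 1, t + 1[%classic s ->
      mu.-integrable `[c, d]%classic (EFin \o F s).
    by move=> _; exact: continuous_segment_integrable (cx' _ cF s).
  have derF (s x : R) : `]t - 1, t + 1[%classic s -> `[c, d]%classic x ->
      derivable (F ^~ x) s 1 by move=> _ _; have [] := dF s x.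
  have intM : mu.-integrable `[c, d]%classic (EFin \o cst M).
    by apply: continuous_segment_integrable => x; exact: cvg_cst.
  have MF (s x : R) : `]t - 1, t + 1[%classic s -> `[c, d]%classic x ->
      `|partial1of2 F s x| <= cst M x.
    rewrite pE /= !in_itv /= => /andP[? ?] ?; apply: (HM s x) => //.
    by apply/andP; split; exact: ltW.
  have mI : measurable (`[c, d]%classic : set (measurableTypeR R)) by exact: measurable_itv.
  apply: DeriveDef.
    exact: (derivable_under_integral mI tI intF derF (fun=> M0) intM MF).
  rewrite -derive1E (differentiation_under_integral mI tI intF derF (fun=> M0) intM MF).
  by apply: eq_Rintegral => x _; rewrite pE.
pose h t x := ut t x ^+ 2 + ux t x ^+ 2.
have intF' t : \int[mu]_(x in `[c, d]%classic) F' t x = \int[mu]_(x in `[c, d]%classic) h t x.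
  (* By harmonicity [g] is the [x]-derivative of [u * ux], so its integral over a period vanishes,
     while [F' = h - g]. *)
  pose g x := ux t x ^+ 2 - u t x * utt t x.
  have cg : continuous g.
    by move=> x; apply: cvgB; apply: cvgM; [exact: (cx' _ cx)|exact: (cx' _ cx)|exact: (cx' _ cu)|exact: (cx' _ ctt)].
  have ch : continuous (h t).
    by move=> x; apply: cvgD; apply: cvgM; [exact: (cx' _ ct)|exact: (cx' _ ct)|exact: (cx' _ cx)|exact: (cx' _ cx)].
  have dg x : is_derive x (1:R) (fun x => u t x * ux t x) (g x).
    apply: (is_derive_eq (is_deriveM (dx t x) (dxx t x))).
    have -> : uxx t x = - utt t x by apply/eqP; rewrite -addr_eq0 addrC lap.
    by rewrite /g /GRing.scale /=; ring.
  have -> : \int[mu]_(x in `[c, d]%classic) F' t x =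
            \int[mu]_(x in `[c, d]%classic) (h t x - g x).
    by apply: eq_Rintegral => x _; rewrite /F' /h /g; ring.
  have cG := is_derive_continuous dg.
  rewrite RintegralB //; try exact: continuous_segment_integrable.
  rewrite -[RHS]subr0; congr (_ - _).
  rewrite /Rintegral (continuous_FTC2 (f := g) (F := fun x => u t x * ux t x) cd).
  - by rewrite /d uq uxq subee.
  - exact: continuous_subspaceT.
  - split; first by move=> x _; exact: ex_derive.
      by apply: cvg_at_right_filter; exact: cG.
    by apply: cvg_at_left_filter; exact: cG.
  - by move=> x _; rewrite derive1E; have [_ ->] := dg x.
have h0 t x : 0 <= h t x by rewrite /h; apply: addr_ge0; exact: sqr_ge0.
have Emono s t : s <= t -> E s <= E t.
  rewrite le_eqVlt => /predU1P[->//|st].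
  have [r _ Er] := MVT_global st dE.
  rewrite -subr_ge0 Er; apply: mulr_ge0; last by rewrite subr_ge0 ltW.
  by rewrite intF'; apply: Rintegral_ge0.
have Ep t : E (t + p) = E t by apply: eq_Rintegral => x _; rewrite /F up utp.
have I0 : \int[mu]_(x in `[c, d]%classic) h t0 x = 0.
  rewrite -intF'.
  suff : is_derive t0 (1:R) E 0 by move=> [_ <-]; have [_ ->] := dE t0.
  apply: (@near_eq_is_derive _ _ _ (cst (E t0))).
  have Em : E (t0 - p) = E t0 by rewrite -Ep subrK.
  (* Between [t0 - p] and [t0 + p] the nondecreasing [E] is squeezed between two values both equal
     to [E t0]. *)
  near=> t; apply/eqP; rewrite eq_le; apply/andP; split.
    rewrite -Em; apply: Emono; apply: ltW; near: t; apply: lt_nbhsr; lra.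
  rewrite -(Ep t0); apply: Emono; apply: ltW; near: t; apply: lt_nbhsl; lra.
have ch : continuous (h t0).
  by move=> x; apply: cvgD; apply: cvgM; exact: (cx' _ _ t0).
have cmd : c < x0 < d by apply/andP; rewrite /d /c; split; lra.
have /eqP := Rintegral_eq0_continuous ch (h0 t0) cmd I0.
by rewrite paddr_eq0 ?sqr_ge0 // !sqrf_eq0 => /andP[/eqP-> /eqP->].
Unshelve. all: by end_near. Qed.

(** * Smooth functions on the group and their partial derivatives *)

Lemma is_derive_line (R : realType) n (f : 'rV[R]_n -> R) (g v : 'rV[R]_n) (s d : R) :
  is_derive (s *: v + g) v f d <-> is_derive s (1:R) (fun s => f (s *: v + g)) d.
Proof.
have E : (fun h : R => h^-1 *: ((f \o shift (s *: v + g)) (h *: v) - f (s *: v + g))) =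
         (fun h : R => h^-1 *: (((fun s => f (s *: v + g)) \o shift s) (h *: (1:R)) - f (s *: v + g))).
  by apply/funext => h /=; rewrite scalerDl addrA [h *: (1:R)]mulr1.
by split=> -[]; rewrite /derivable /derive => D1 D2; split; rewrite /derivable /derive;
  rewrite ?E // -?E.
Qed.

Section Smooth.
Variable R : realType.
Implicit Types (u v : 'rV[R]_6 -> R) (g : 'rV[R]_6) (k l : 'I_6).

Lemma smoothR_pdR u k : smoothR u -> smoothR (pdR k u).
Proof. by move=> su l; have := su (rcons l k); rewrite foldr_rcons. Qed.

Lemma smoothR_continuous u : smoothR u -> continuous u.
Proof. by move=> su; have [] := su [::]. Qed.

Lemma smoothR_is_derive u k g : smoothR u -> is_derive g (unitv R k) u (pdR k u g).
Proof. by move=> su; apply: derivableP; have [_] := su [::]; apply. Qed.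

Lemma smoothR_derive_line u k g (s : R) : smoothR u ->
  is_derive s (1:R) (fun s => u (s *: unitv R k + g)) (pdR k u (s *: unitv R k + g)).
Proof. by move=> su; apply/is_derive_line; exact: smoothR_is_derive. Qed.

Lemma continuous_plane (a b g : 'rV[R]_6) u : continuous u ->
  continuous (fun z : R * R => u (z.1 *: a + (z.2 *: b + g))).
Proof.
move=> cu z; apply: (@continuous_comp _ _ _ (fun z : R * R => z.1 *: a + (z.2 *: b + g)) u).
  apply: cvgD; last apply: cvgD; last exact: cvg_cst.
    by apply: cvgZr_tmp; exact: cvg_fst.
  by apply: cvgZr_tmp; exact: cvg_snd.
exact: cu.
Qed.

(** Schwarz's theorem: on the affine plane through [g] in the directions [k] and [l] it becomes
    [mixed_partials_eq] at the origin. *)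
Lemma pdR_comm u k l g : smoothR u -> pdR k (pdR l u) g = pdR l (pdR k u) g.
Proof.
move=> su.
pose f (w : 'rV[R]_6 -> R) (s r : R) := w (s *: unitv R k + (r *: unitv R l + g)).
have d1 w : smoothR w -> forall s r, is_derive s (1:R) (f w ^~ r) (f (pdR k w) s r).
  by move=> sw s r; exact: smoothR_derive_line.
have d2 w : smoothR w -> forall s r, is_derive r (1:R) (f w s) (f (pdR l w) s r).
  move=> sw s r; rewrite /f addrCA.
  have -> : (fun r => w (s *: unitv R k + (r *: unitv R l + g))) =
            (fun r => w (r *: unitv R l + (s *: unitv R k + g))).
    by apply/funext => x; rewrite addrCA.
  exact: smoothR_derive_line.
have sk := smoothR_pdR k su; have sl := smoothR_pdR l su.
have c w : smoothR w -> continuous (fun z : R * R => f w z.1 z.2).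
  by move=> sw; apply: continuous_plane; exact: smoothR_continuous.
have f0 w : f w 0 0 = w g by rewrite /f scale0r scale0r add0r add0r.
rewrite -[LHS]f0 -[RHS]f0; symmetry.
exact: (mixed_partials_eq (d1 _ su) (d2 _ su) (d2 _ sk) (d1 _ sl)
  (c _ (smoothR_pdR l sk) (0, 0)) (c _ (smoothR_pdR k sl) (0, 0))).
Qed.

Lemma pdR_scale u k g (c : R) : smoothR u -> pdR k (fun g => c * u g) g = c * pdR k u g.
Proof.
by move=> su; rewrite /pdR -[RHS]/(c *: _) -deriveZ //; have [] := smoothR_is_derive k g su.
Qed.

Lemma crd_line g k n (s : R) : (n < 6)%N ->
  crd (s *: unitv R k + g) n = s * (nat_of_ord k == n)%:R + crd g n.
Proof.
move=> n6; rewrite /crd !mxE eqxx /= eq_sym; congr (_ * _%:R + _).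
by rewrite -(inj_eq val_inj) /= inordK.
Qed.

Lemma is_derive_expR2t k g :
  is_derive g (unitv R k) (fun g => expR (2 * crd g 0))
    ((k == 0%N :> nat)%:R * 2 * expR (2 * crd g 0)).
Proof.
have := @is_derive_line R 6 (fun g => expR (2 * crd g 0)) g (unitv R k) 0.
rewrite scale0r add0r => H; apply/H => {H}.
under eq_fun do rewrite crd_line //.
pose b : R := (k == 0%N :> nat)%:R; rewrite -/b.
have D : is_derive (0:R) (1:R) (fun s => 2 * (s * b + crd g 0)) (2 * b).
  apply: is_derive_eq; rewrite /GRing.scale /=; ring.
have := @is_derive1_comp _ expR (fun s => 2 * (s * b + crd g 0)) 0 _ _ (is_derive_expR _) D.
rewrite mul0r add0r => H; apply: (is_derive_eq H); ring.
Qed.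

Lemma pdR_expR2t_mul u k g (c : R) : smoothR u ->
  pdR k (fun g => c * (expR (2 * crd g 0) * u g)) g =
  c * ((k == 0%N :> nat)%:R * 2 * expR (2 * crd g 0) * u g +
       expR (2 * crd g 0) * pdR k u g).
Proof.
move=> su.
have [_] := is_deriveZ c (is_deriveM (is_derive_expR2t k g) (smoothR_is_derive k g su)).
by rewrite /GRing.scale /= => H; rewrite {1}/pdR H; ring.
Qed.

Definition o6 (n : nat) : 'I_6 := inord n.

Lemma val_o6 n : (n < 6)%N -> nat_of_ord (o6 n) = n.
Proof. by move=> h; rewrite inordK. Qed.

(* The commutator of [d_t + i d_x] and [e^t d_k + i e^-t d_l] is
   [e^t d_k - i e^-t d_l], so a function killed by the first two is killed by
   [d_k] as well; [c = 1] is this statement for [u + i v], [c = -1] for [v + i u]. *)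
Lemma pdR_eq0_of_bracket u v k l (c : R) : c * c = 1 -> smoothR u -> smoothR v ->
  (forall g, pdR (o6 0) u g = c * pdR (o6 1) v g) ->
  (forall g, pdR (o6 0) v g = - c * pdR (o6 1) u g) ->
  (forall g, pdR l v g = c * (expR (2 * crd g 0) * pdR k u g)) ->
  (forall g, pdR l u g = - c * (expR (2 * crd g 0) * pdR k v g)) ->
  forall g, pdR k u g = 0.
Proof.
move=> cc su sv h1 h2 h3 h4 g.
have sku := smoothR_pdR k su; have skv := smoothR_pdR k sv.
pose W := expR (2 * crd g 0).
have e1 : pdR (o6 0) (pdR l v) g = c * (2 * W * pdR k u g + W * pdR (o6 0) (pdR k u) g).
  rewrite (_ : pdR l v = (fun g => c * (expR (2 * crd g 0) * pdR k u g))); last exact/funext.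
  by rewrite (pdR_expR2t_mul (o6 0) g c sku) (val_o6 (n := 0) isT) mul1r.
have e2 : pdR (o6 1) (pdR l u) g = - c * (W * pdR (o6 1) (pdR k v) g).
  rewrite (_ : pdR l u = (fun g => - c * (expR (2 * crd g 0) * pdR k v g))); last exact/funext.
  rewrite (pdR_expR2t_mul (o6 1) g (- c) skv) (val_o6 (n := 1) isT) -/W.
  by move: (pdR k v g) (pdR _ _ g) (W) => x y w; rewrite /=; ring.
have e3 n : pdR n (pdR (o6 0) u) g = c * pdR n (pdR (o6 1) v) g.
  rewrite (_ : pdR (o6 0) u = (fun g => c * pdR (o6 1) v g)); last exact/funext.
  exact: (pdR_scale _ _ _ (smoothR_pdR _ sv)).
have e4 n : pdR n (pdR (o6 0) v) g = - c * pdR n (pdR (o6 1) u) g.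
  rewrite (_ : pdR (o6 0) v = (fun g => - c * pdR (o6 1) u g)); last exact/funext.
  exact: (pdR_scale _ _ _ (smoothR_pdR _ su)).
(* After commuting derivatives, both sides of [e1] contain the same term in the derivative of
   [pdR k v] along [x]. What survives is [2 * W * pdR k u], produced by differentiating [e^(2t)]. *)
rewrite (pdR_comm _ _ _ sv) e4 (pdR_comm _ _ _ su) e2 in e1.
rewrite (pdR_comm _ _ _ su) e3 (pdR_comm _ _ _ sv) in e1.
have W0 : W != 0 by rewrite gt_eqF ?expR_gt0.
move: e1 W0 cc; move: (pdR k u g) (pdR _ _ g) (W) => x y w e1 w0 cc.
have : c * c * (2 * (w * x)) = 0.
  have -> : c * c * (2 * (w * x)) =
            c * (c * (2 * w * x + w * (c * y))) - (c * c) * c * w * y by ring.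
  by rewrite -e1; ring.
by rewrite cc mul1r => /eqP; rewrite !mulf_eq0 pnatr_eq0 (negPf w0) => /eqP.
Qed.

End Smooth.

(** * Lattice invariance and constancy *)

Section Invariant.
Variable R : realType.
Implicit Types (u v : 'rV[R]_6 -> R) (g : 'rV[R]_6).

Lemma crd_mk6 (a b c d e f : R) n : (n < 6)%N ->
  crd (mk6 a b c d e f) n = nth 0 [:: a; b; c; d; e; f] n.
Proof. by move=> n6; rewrite /crd mxE inordK. Qed.

(** The final summand [0] gives the shape [s *: unitv R k + g] expected by [crd_line],
    [smoothR_derive_line] and [continuous_plane]. *)
Definition slice (t x : R) : 'rV[R]_6 := t *: unitv R (o6 0) + (x *: unitv R (o6 1) + 0).

Lemma crd_inj g h : (forall n, (n < 6)%N -> crd g n = crd h n) -> g = h.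
Proof.
by move=> H; apply/rowP => i; have := H i (ltn_ord i); rewrite /crd inord_val.
Qed.

Lemma crd0 n : crd (0 : 'rV[R]_6) n = 0.
Proof. by rewrite /crd mxE. Qed.

(** The [y] and [z] directions come outermost, so that [constant_along] strips them one by one. *)
Lemma rV6_decomp g :
  g = crd g 5 *: unitv R (o6 5) + (crd g 4 *: unitv R (o6 4) +
     (crd g 3 *: unitv R (o6 3) + (crd g 2 *: unitv R (o6 2) + slice (crd g 0) (crd g 1)))).
Proof.
apply: crd_inj => n n6; rewrite !crd_line // !val_o6 // crd0.
by case: n n6 => [|[|[|[|[|[|//]]]]]] _ /=; rewrite ?mulr1 ?mulr0 ?add0r ?addr0.
Qed.

(** The group law is additive on the subgroup [y = z = 0], so invariance under the lattice becomes
    double periodicity with periods [a0] and 1. *)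
Lemma Gmul_slice (a b t x : R) :
  Gmul (mk6 a b 0 0 0 0) (slice t x) = slice (t + a) (x + b).
Proof.
apply: crd_inj => n n6; rewrite /Gmul !(crd_line _ _ _ n6) !val_o6 // crd0.
rewrite crd_mk6 // !(crd_line _ _ _ (isT : (0 < 6)%N)) !crd_line // !val_o6 // !crd0 !crd_mk6 //.
case: n n6 => [|[|[|[|[|[|//]]]]]] _ /=; ring.
Qed.

Lemma inGamma_translation (a0 : R) (P : 'M[R]_2) (k l : int) :
  inGamma a0 P (mk6 (k%:~R * a0) l%:~R 0 0 0 0).
Proof.
exists k, l, 0, 0, 0, 0; rewrite !crd_mk6 //=.
by split=> //; split=> //; split; rewrite !mul0r addr0.
Qed.

Lemma constant_along u k : smoothR u -> (forall g, pdR k u g = 0) ->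
  forall (s : R) g, u (s *: unitv R k + g) = u g.
Proof.
move=> su ku s g.
rewrite (@derive0_constant R (fun s => u (s *: unitv R k + g)) _ s 0) ?scale0r ?add0r // => x.
by apply: (is_derive_eq (smoothR_derive_line k g x su)).
Qed.

(** The sign [c] lets one statement serve the real part ([c = 1]) and the imaginary part ([c = -1])
    of a complex function. *)
Lemma invariant_holomorphic_constant (a0 c : R) (P : 'M[R]_2) u v :
  0 < a0 -> c * c = 1 -> smoothR u -> smoothR v ->
  (forall gam g, inGamma a0 P gam -> u (Gmul gam g) = u g) ->
  (forall g, pdR (o6 0) u g = c * pdR (o6 1) v g) ->
  (forall g, pdR (o6 0) v g = - c * pdR (o6 1) u g) ->
  (forall k l, (k, l) \in [:: (o6 2, o6 3); (o6 4, o6 5)] -> forall g,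
     pdR l v g = c * (expR (2 * crd g 0) * pdR k u g) /\
     pdR l u g = - c * (expR (2 * crd g 0) * pdR k v g)) ->
  forall g, u g = u 0.
Proof.
move=> a00 cc su sv inv h1 h2 h3 g.
(* The system is unchanged when [u] and [v] are exchanged and [c] becomes [- c]. The bracket
   argument therefore also kills [pdR k v], and [h5] then kills [pdR l u]. *)
have h1' g' : pdR (o6 0) v g' = (- c) * pdR (o6 1) u g' by rewrite h2.
have h2' g' : pdR (o6 0) u g' = - (- c) * pdR (o6 1) v g' by rewrite h1 opprK.
have cc' : - c * - c = 1 by rewrite mulrNN.
have u0 k l : (k, l) \in [:: (o6 2, o6 3); (o6 4, o6 5)] ->
    (forall g, pdR k u g = 0) /\ (forall g, pdR l u g = 0).
  move=> kl.
  have h4 g' := (h3 _ _ kl g').1; have h5 g' := (h3 _ _ kl g').2.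
  have h4' g' : pdR l v g' = - (- c) * (expR (2 * crd g' 0) * pdR k u g').
    by rewrite opprK; exact: h4.
  have v0 := pdR_eq0_of_bracket cc' sv su h1' h2' h5 h4'.
  split; first exact: (pdR_eq0_of_bracket cc su sv h1 h2 h4 h5).
  by move=> g'; rewrite h5 v0 !mulr0.
have [u2 u3] := u0 (o6 2) (o6 3) (mem_head _ _).
have [u4 u5] := u0 (o6 4) (o6 5) (mem_last (o6 2, o6 3) [:: (o6 4, o6 5)]).
rewrite (rV6_decomp g) (constant_along su u5) (constant_along su u4) (constant_along su u3)
  (constant_along su u2).
pose f w (t x : R) : R := w (slice t x).
have d1 w : smoothR w -> forall t x, is_derive t (1:R) (f w ^~ x) (f (pdR (o6 0) w) t x).
  by move=> sw t x; exact: smoothR_derive_line.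
have d2 w : smoothR w -> forall t x, is_derive x (1:R) (f w t) (f (pdR (o6 1) w) t x).
  move=> sw t x; rewrite /f /slice addrCA.
  have -> : (fun r => w (t *: unitv R (o6 0) + (r *: unitv R (o6 1) + 0))) =
            (fun r => w (r *: unitv R (o6 1) + (t *: unitv R (o6 0) + 0))).
    by apply/funext => r; rewrite addrCA.
  exact: smoothR_derive_line.
have cf w : smoothR w -> continuous (fun z : R * R => f w z.1 z.2).
  by move=> sw; apply: continuous_plane; exact: smoothR_continuous.
have s0 := smoothR_pdR (o6 0) su; have s1 := smoothR_pdR (o6 1) su.
have up t x : f u (t + a0) x = f u t x.
  have := inv _ (slice t x) (inGamma_translation a0 P 1 0).
  by rewrite Gmul_slice mul1r addr0.
have uq t x : f u t (x + 1) = f u t x.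
  have := inv _ (slice t x) (inGamma_translation a0 P 0 1).
  by rewrite Gmul_slice mul0r addr0.
(* By the Cauchy-Riemann equations [u_tt = c v_xt = c v_tx = - c^2 u_xx]. *)
have lap t x : f (pdR (o6 0) (pdR (o6 0) u)) t x + f (pdR (o6 1) (pdR (o6 1) u)) t x = 0.
  rewrite /f (_ : pdR (o6 0) u = (fun g => c * pdR (o6 1) v g)); last exact/funext.
  rewrite (pdR_scale _ _ _ (smoothR_pdR _ sv)) (pdR_comm _ _ _ sv).
  rewrite (_ : pdR (o6 0) v = (fun g => - c * pdR (o6 1) u g)); last exact/funext.
  rewrite (pdR_scale _ _ _ s1) mulrA mulrN cc mulN1r; exact: addNr.
have Z := biperiodic_harmonic_constant a00 ltr01 up uq (d1 _ su) (d2 _ su)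
  (d1 _ s0) (d2 _ s1) (cf _ su) (cf _ s0) (cf _ s1) (cf _ (smoothR_pdR (o6 0) s0)) lap.
have D1 x t : is_derive t (1:R) (f u ^~ x) 0.
  by rewrite -[X in is_derive _ _ _ X](Z t x).1; exact: d1.
have D2 t x : is_derive x (1:R) (f u t) 0.
  by rewrite -[X in is_derive _ _ _ X](Z t x).2; exact: d2.
have slice0 : slice 0 0 = 0 by rewrite /slice !scale0r !addr0.
have e1 : f u (crd g 0) (crd g 1) = f u 0 (crd g 1) := derive0_constant (D1 _) _ _.
have e2 : f u 0 (crd g 1) = f u 0 0 := derive0_constant (D2 _) _ _.
exact: etrans e1 (etrans e2 (f_equal u slice0)).
Qed.

End Invariant.

(* Exterior algebra in the coframe, indexed by finite sets *)
From mathcomp Require Import fintype finset.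

Section Forms.
Variable R : realType.
Implicit Types (a b w : Defs.form R) (S T U V A : {set 'I_6}) (g : 'rV[R]_6).

Lemma wsign_neq0 S T : [disjoint S & T] -> wsign R S T != 0.
Proof. by rewrite /wsign => ->; rewrite signr_eq0. Qed.

Lemma wsign_set1 (x y : 'I_6) : x != y -> wsign R [set x] [set y] = (-1) ^+ (y < x)%N.
Proof.
move=> xy; rewrite /wsign disjoints1 in_set1 xy; congr (_ ^+ _).
case yx : (y < x)%N; last first.
  apply/eqP; rewrite cards_eq0; apply/eqP/setP => -[p q].
  by rewrite !inE /=; case: eqP => //= ->; case: eqP => //= ->.
apply/eqP/cards1P; exists (x, y); apply/setP => -[p q]; rewrite !inE /= xpair_eqE.
by case: eqP => //= ->; case: eqP => //= ->.
Qed.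

(** A term of the double sum needs its first index set disjoint from [T] with union [U], which
    leaves only [U :\: T]. *)
Lemma wedge_basis a T U g :
  wedge a (@Defs.basis R T) U g =
  if T \subset U then wsign R (U :\: T) T * a (U :\: T) g else 0.
Proof.
rewrite /wedge; transitivity (\sum_S (if S :|: T == U then wsign R S T * a S g else 0)).
  apply: eq_bigr => S _; rewrite big_mkcond (bigD1 T) //= big1 ?addr0.
    by rewrite /Defs.basis eqxx mulr1.
  by move=> T' nT; rewrite /Defs.basis (negPf nT) mulr0 if_same.
case: ifPn => TU; last first.
  rewrite big1 // => S _; case: eqP => // E; case/negP: TU.
  by rewrite -E subsetUr.
rewrite (bigD1 (U :\: T)) //= big1 ?addr0.
  have -> : U :\: T :|: T = U by rewrite -{2}(setIidPr TU) setUC setID.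
  by rewrite eqxx.
move=> S nS; case: eqP => // E; rewrite /wsign; case: ifP => [D|_]; last by rewrite mul0r.
by case/eqP: nS; rewrite -E setDUl setDv setU0; apply/esym/setDidPl.
Qed.

Lemma wedge_expand a b U g :
  wedge a b U g = \sum_T b T g * wedge a (@Defs.basis R T) U g.
Proof.
rewrite /wedge; under [RHS]eq_bigr do rewrite mulr_sumr.
rewrite exchange_big /=; apply: eq_bigr => S _.
transitivity (\sum_T (if S :|: T == U then wsign R S T * a S g * b T g else 0)).
  by rewrite -big_mkcond.
apply: eq_bigr => T _; rewrite [in RHS]big_mkcond (bigD1 T) //= big1 ?addr0.
  by rewrite /Defs.basis eqxx mulr1; case: ifP; rewrite ?mulr0 // mulrC.
by move=> T' nT; rewrite /Defs.basis (negPf nT) mulr0 if_same.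
Qed.

(** A [form] may mix degrees; this singles out pure degree [n], so that most terms of wedge products
    vanish by counting indices. *)
Definition homog (n : nat) w := forall U g, #|U| != n -> w U g = 0.

Lemma homog_wedge m n a b : homog m a -> homog n b -> homog (m + n) (wedge a b).
Proof.
move=> ha hb U g cU; rewrite wedge_expand big1 // => T _.
rewrite wedge_basis; case: ifP => TU; last by rewrite mulr0.
have [cT|/hb ->] := eqVneq #|T| n; last by rewrite mul0r.
rewrite ha ?mulr0 //; apply: contraNneq cU => cD.
by rewrite -(cardsID T U) (setIidPr TU) cT cD addnC.
Qed.

Lemma homog_basis S : homog #|S| (@Defs.basis R S).
Proof. by move=> U g; rewrite /Defs.basis; case: (eqVneq U S) => [->|//]; rewrite eqxx. Qed.

Lemma homog_zero n : homog n (@fzero R). Proof. by []. Qed.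

Lemma homog_add n a b : homog n a -> homog n b -> homog n (fadd a b).
Proof. by move=> ha hb U g h; rewrite /fadd ha // hb // addr0. Qed.

Lemma homog_sub n a b : homog n a -> homog n b -> homog n (fsub a b).
Proof. by move=> ha hb U g h; rewrite /fsub ha // hb // subr0. Qed.

Lemma homog_scale n c a : homog n a -> homog n (fscale c a).
Proof. by move=> ha U g h; rewrite /fscale ha // mulr0. Qed.

Lemma homog_ef k : homog 1 (@ef R k).
Proof.
have h1 (i : 'I_6) : homog 1 (@Defs.basis R [set i]) by have := @homog_basis [set i]; rewrite cards1.
by rewrite /ef; case: ifP => _; apply: homog_scale; [apply: homog_add|apply: homog_sub];
  exact: h1.
Qed.

Lemma homog_de k : homog 2 (@de R k).
Proof.
have h i j : homog 2 (@e2 R i j) by apply: (homog_wedge (m := 1) (n := 1)); exact: homog_ef.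
rewrite /de; move: k => [|[|[|[|[|[|[|k]]]]]]]; try exact: homog_zero; try exact: h.
- by apply: homog_sub => //; exact: homog_scale.
- exact: homog_sub.
- exact: homog_scale.
Qed.

Lemma homog_dtheta s : homog 2 (@dtheta R s).
Proof.
by rewrite /dtheta; case: ifP => _; [apply: homog_add|apply: homog_sub];
  try apply: homog_scale; exact: homog_de.
Qed.

Lemma homog_dfun f : homog 1 (@dfun R f).
Proof.
move=> U g cU; rewrite /dfun big1 // => c _.
suff -> : dcoord c U g = 0 by rewrite mulr0.
by rewrite /dcoord; case: (val c) => [|[|[|[|[|?]]]]]; rewrite !homog_ef // ?mulr0 ?addr0.
Qed.

Lemma wedge_one_forms a b (x y : 'I_6) g : (x < y)%N -> homog 1 a -> homog 1 b ->
  wedge a b [set x; y] g =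
  a [set x] g * b [set y] g - a [set y] g * b [set x] g.
Proof.
move=> xy ha hb; have nxy : x != y by rewrite -(inj_eq val_inj) /= ltn_eqF.
have nyx : y != x by rewrite eq_sym.
rewrite wedge_expand (bigD1 [set y]) //= (bigD1 [set x]) /=; last first.
  by rewrite (inj_eq set1_inj).
rewrite big1 ?addr0; last first.
  move=> T /andP[Ty Tx]; have [cT|/hb ->] := eqVneq #|T| 1%N; last by rewrite mul0r.
  rewrite wedge_basis; case: ifP => TU; last by rewrite mulr0.
  case/cards1P: (introT eqP cT) => z Tz; move: TU Ty Tx.
  by rewrite Tz sub1set !(inj_eq set1_inj) !inE orbC => /orP[] ->.
rewrite !wedge_basis !sub1set !inE !eqxx orbT /=.
have -> : [set x; y] :\: [set y] = [set x].
  by apply/setP => z; rewrite !inE; case: (eqVneq z y) => [->|] //=; rewrite ?orbF // eq_sym (negPf nxy).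
have -> : [set x; y] :\: [set x] = [set y].
  by apply/setP => z; rewrite !inE; case: (eqVneq z x) => [->|] //=; rewrite (negPf nxy).
rewrite !wsign_set1 // xy ltnNge (ltnW xy) /= expr0 expr1; ring.
Qed.

End Forms.

(** * The (0,2)-components of the structure equations and the equation [mubar psi = 0] *)

Section Coefficients.
Variable R : realType.
Implicit Types (w : Defs.form R) (S U V A : {set 'I_6}) (g : 'rV[R]_6) (i s : 'I_6).

Lemma Phi_set1 j i g : (j < 6)%N -> @Phi R j [set i] g = (nat_of_ord i == j)%:R.
Proof. by move=> j6; rewrite /Phi /Defs.basis (inj_eq set1_inj) -(inj_eq val_inj) /= inordK. Qed.

Lemma Phibar_set1 j i g : (j < 3)%N -> @Phibar R j [set i] g = (nat_of_ord i == j + 3)%N%:R.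
Proof.
move=> j3; rewrite /Phibar /Defs.basis (inj_eq set1_inj) -(inj_eq val_inj) /= inordK //.
by rewrite (@leq_ltn_trans (2 + 3)) // leq_add2r -ltnS.
Qed.

Lemma inv_2iC : (2 * iC R)^-1 = Complex 0 (- 2^-1).
Proof.
have H : 2 * iC R * Complex 0 (- 2^-1) = 1.
  rewrite /iC [2]mulr2n mulrDl mul1r; simpc.
  by congr Complex; field.
have nz : 2 * iC R != 0.
  by apply/eqP => Z; move: H; rewrite Z mul0r => /eqP; rewrite eq_sym oner_eq0.
by apply: (mulfI nz); rewrite divff.
Qed.

(** Only the conjugate term of [ef k] is seen here; its coefficient is 1/2 for odd [k] and -1/(2i) =
    i/2 for even [k]. *)
Lemma ef_antiholomorphic k i g : (0 < k <= 6)%N -> (3 <= i)%N ->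
  @ef R k [set i] g =
  if (nat_of_ord i == (k.-1)./2 + 3)%N then
    if odd k then Complex 2^-1 0 else Complex 0 2^-1
  else 0.
Proof.
move=> k6 i3.
have j3 : ((k.-1)./2 < 3)%N by move: k k6 => [|[|[|[|[|[|[|]]]]]]].
have ni : (nat_of_ord i == (k.-1)./2) = false.
  by apply/negbTE; rewrite neq_ltn (leq_trans j3 i3) orbT.
have j6 : ((k.-1)./2 < 6)%N by exact: ltn_trans j3 _.
rewrite /ef /fscale; case: (odd k); rewrite /fadd /fsub Phi_set1 // Phibar_set1 // ni;
  case: (_ == _); rewrite ?subrr ?add0r ?mulr0 ?mulr1 // inv_2iC mulrN1.
by congr Complex; rewrite ?oppr0 ?opprK.
Qed.

(* The indices of [conj Phi^1] and [conj Phi^(s+1)]; for [s = 1, 2] the component of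
   [d Phi^(s+1)] on [anti s] is [-1/2], and no other [d Phi^r] has such a component. *)
Definition anti (s : 'I_6) : {set 'I_6} := [set o6 3; o6 (s + 3)].

(** On the diagonal, [- e^13 + i e^14] and [- e^15 + i e^16] each give -1/4 - 1/4. Off it, the terms
    [- e^25] and [- i e^26] of [d Phi^2] contribute -i/4 and i/4 on [anti 2] and cancel. *)
Lemma dtheta_anti (r s : 'I_6) g : (r < 3)%N -> (0 < s < 3)%N ->
  @dtheta R r (anti s) g = if r == s then Complex (- 2^-1) 0 else 0.
Proof.
move=> r3 s3; rewrite /anti.
have lt : (nat_of_ord (o6 3) < o6 (s + 3))%N.
  by rewrite !val_o6 //; move: (nat_of_ord s) s3 => [|[|[|]]].
have e2E a b :
    @e2 R a b [set o6 3; o6 (s + 3)] g =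
    @ef R a [set o6 3] g * @ef R b [set o6 (s + 3)] g -
    @ef R a [set o6 (s + 3)] g * @ef R b [set o6 3] g.
  by apply: wedge_one_forms => //; exact: homog_ef.
rewrite /dtheta r3 /fadd /fscale -(inj_eq val_inj) /=.
have v3 : nat_of_ord (o6 3) = 3 by rewrite val_o6.
have vs : nat_of_ord (o6 (s + 3)) = (s + 3)%N.
  by rewrite val_o6 //; move: (nat_of_ord s) s3 => [|[|[|]]].
move: (nat_of_ord r) r3 => [|[|[|//]]] _; rewrite /de /= ?/fsub ?/fscale ?e2E //
  ?ef_antiholomorphic ?v3 ?vs // /=.
all: try exact: leq_addl.
all: move: (nat_of_ord s) s3 => [|[|[|//]]] // _ /=; rewrite /fzero ?mulr0 ?addr0 ?subr0 ?mulN1r //.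
all: by rewrite /iC; simpc; congr Complex; field.
Qed.

Definition low : {set 'I_6} := [set i : 'I_6 | (i < 3)%N].

(** An equality of functions, so that it can be rewritten under [dfun]. *)
Lemma is_type_low p w S : is_type p 0 w -> ~~ (S \subset low) -> w S = fun=> 0.
Proof.
move=> tw nS; apply/funext => g; apply: tw; apply: contra nS => /andP[_].
rewrite cards_eq0 => /eqP S0; apply/subsetP => i iS; rewrite inE ltnNge.
by have /setP/(_ i) := S0; rewrite !inE iS /= => ->.
Qed.

Lemma dfun_cst (c : R[i]) U g : dfun (fun=> c) U g = 0.
Proof.
rewrite /dfun big1 // => k _; rewrite /pd /pdR /=.
have E (x : R) : 'D_(unitv R k) (fun=> x) g = 0 by exact: derive_cst.
by rewrite !E mul0r.
Qed.

Lemma anti_disjoint_low s S : (0 < s < 3)%N -> S \subset low -> [disjoint anti s & S].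
Proof.
move=> s3 Sl; rewrite disjoint_subset; apply/subsetP => i; rewrite !inE => ia.
apply/negP => iS; have := subsetP Sl _ iS; rewrite inE ltnNge => /negP; apply.
by case/orP: ia => /eqP ->; rewrite val_o6 ?leq_addl //; move: (nat_of_ord s) s3 => [|[|[|]]].
Qed.

Lemma card_anti s : (0 < s < 3)%N -> #|anti s| = 2.
Proof.
move=> s3; rewrite cards2 -(inj_eq val_inj) /= !val_o6 //;
  by move: (nat_of_ord s) s3 => [|[|[|]]].
Qed.

Lemma anti_subset s A S : (0 < s < 3)%N -> S \subset low ->
  anti s \subset (A :|: anti s) :\: S.
Proof. by move=> s3 Sl; rewrite subsetD subsetUr anti_disjoint_low. Qed.

(** The index set contains both elements of [anti s], too many for a 1-form. This is why derivatives
    of coefficients do not enter [mubar]. *)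
Lemma one_form_anti (a : Defs.form R) s A S g : (0 < s < 3)%N -> S \subset low ->
  homog 1 a -> a ((A :|: anti s) :\: S) g = 0.
Proof.
move=> s3 Sl ha; apply: ha; rewrite neq_ltn; apply/orP; right.
apply: (@leq_trans #|anti s|); first by rewrite card_anti.
by apply: subset_leq_card; exact: anti_subset.
Qed.

(** An index set of size two that contains [anti s] equals it, which forces [S = A]. *)
Lemma two_form_anti (a : Defs.form R) s A S g : (0 < s < 3)%N -> A \subset low ->
  S \subset low -> homog 2 a -> S \subset A :|: anti s ->
  a ((A :|: anti s) :\: S) g = if S == A then a (anti s) g else 0.
Proof.
move=> s3 Al Sl ha SU.
have UV (B : {set _}) : B \subset low -> (A :|: anti s) :\: B = (A :\: B) :|: anti s.
  by move=> Bl; rewrite setDUl (setDidPl (anti_disjoint_low s3 Bl)).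
case: eqP => [->|SA]; first by rewrite UV // setDv set0U.
apply: ha; apply/eqP => c2; apply: SA.
have E : anti s = (A :|: anti s) :\: S.
  by apply/eqP; rewrite eqEcard anti_subset // c2 card_anti.
apply/eqP; rewrite eqEsubset; apply/andP; split; apply/subsetP => i iA.
  have := subsetP SU _ iA; rewrite inE => /orP[//|ia].
  by have := disjointFr (anti_disjoint_low s3 Sl) ia; rewrite iA.
apply: contraT => iS; have : i \in anti s by rewrite E !inE iS iA.
by move/(disjointFr (anti_disjoint_low s3 Al)); rewrite iA.
Qed.

(** In the Leibniz sum only the factor [s] can be replaced by [anti s], and the remaining factors
    must then be [A]. The constant is the Leibniz sign times the wedge sign times -1/2. *)
Lemma dbasis_anti s A S g : (0 < s < 3)%N -> A \subset low -> S \subset low -> s \notin A ->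
  exists2 c : R[i], c != 0 &
    dbasis S (A :|: anti s) g = if S == s |: A then c else 0.
Proof.
move=> s3 Al Sl sA.
exists ((-1) ^+ #|[set u in s |: A | (u < s)%N]| * (wsign R (anti s) A * Complex (- 2^-1) 0)).
  rewrite !mulf_neq0 ?signr_eq0 ?wsign_neq0 ?anti_disjoint_low //.
  by rewrite eq_complex /= oppr_eq0 invr_eq0 pnatr_eq0.
have term (r : 'I_6) : r \in S ->
    wedge (dtheta r) (@Defs.basis R (S :\ r)) (A :|: anti s) g =
    if (r == s) && (S :\ r == A) then wsign R (anti s) A * Complex (- 2^-1) 0 else 0.
  move=> rS; have r3 : (r < 3)%N by have := subsetP Sl _ rS; rewrite inE.
  have Srl : S :\ r \subset low := subset_trans (subsetDl _ _) Sl.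
  rewrite wedge_basis; case: ifP => SU.
    rewrite two_form_anti //; last exact: homog_dtheta.
    case: (eqVneq (S :\ r) A) => [E|_]; last by rewrite andbF mulr0.
    rewrite andbT dtheta_anti //; case: (r == s); rewrite ?mulr0 // E.
    by rewrite setDUl setDv set0U (setDidPl (anti_disjoint_low s3 Al)).
  case: ifP => // /andP[_ /eqP E]; move: SU; rewrite E subsetUl; done.
rewrite /dbasis; case: ifP => [/eqP SE|SE].
  have sS : s \in S by rewrite SE setU11.
  have SA : S :\ s = A by rewrite SE setU1K.
  rewrite (bigD1 s) //= term // eqxx SA eqxx /= big1 ?addr0 -?SE //.
  by move=> r /andP[rS rs]; rewrite term // (negPf rs) mulr0.
rewrite big1 // => r rS; rewrite term //; case: eqP => [rs|]; rewrite /= ?mulr0 //.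
case: eqP => [E|]; rewrite ?mulr0 //.
by move: SE; rewrite -E rs setD1K ?eqxx // -rs.
Qed.

(* The [(p-1,2)]-part of [dw] is algebraic in [w], and its component on
   [A :|: anti s] isolates the coefficient of [w] on [s |: A]. *)
Lemma dform_anti p w s A g : is_type p 0 w -> (0 < s < 3)%N -> A \subset low -> s \notin A ->
  exists2 c : R[i], c != 0 & dform w (A :|: anti s) g = w (s |: A) g * c.
Proof.
move=> tw s3 Al sA.
have sl : s |: A \subset low.
  by rewrite subUset Al andbT sub1set inE; case/andP: s3.
have [c c0 E] := dbasis_anti g s3 Al sl sA.
exists c => //; rewrite /dform.
have D S : wedge (dfun (w S)) (@Defs.basis R S) (A :|: anti s) g = 0.
  have [Sl|nS] := boolP (S \subset low); last first.
    by rewrite (is_type_low tw nS) wedge_basis dfun_cst mulr0 if_same.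
  by rewrite wedge_basis one_form_anti ?mulr0 ?if_same //; exact: homog_dfun.
rewrite (bigD1 (s |: A)) //= big1 ?addr0; first by rewrite D add0r E eqxx.
move=> S nS; rewrite D add0r; have [Sl|nSl] := boolP (S \subset low); last first.
  by rewrite (is_type_low tw nSl) mul0r.
by have [d _ ->] := dbasis_anti g s3 Al Sl sA; rewrite (negPf nS) mulr0.
Qed.

(** For [S] of type (p,0), the set [S :\ s :|: anti s] has type (p-1,2), so the component isolated
    by [dform_anti] belongs to [mubar p 0 w]. *)
Lemma mubar_eq0 p w s S g : is_type p 0 w -> form_eq0 (mubar p 0 w) ->
  (0 < s < 3)%N -> s \in S -> w S g = 0.
Proof.
move=> tw mw s3 sS.
have [Sl|nS] := boolP (S \subset low); last by rewrite (is_type_low tw nS).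
have [cS|nS] := eqVneq #|S| p; last first.
  apply: tw; apply: contra nS => /andP[/eqP <- _]; apply/eqP; apply: eq_card => i.
  by rewrite inE; case iS : (i \in S) => //=; have := subsetP Sl _ iS; rewrite inE.
have Al : S :\ s \subset low := subset_trans (subsetDl _ _) Sl.
have sA : s \notin S :\ s by rewrite !inE eqxx.
have lowA i : i \in S :\ s -> (i < 3)%N by move/(subsetP Al); rewrite inE.
have lowV i : i \in anti s -> (i < 3)%N = false.
  by move/(disjointFr (anti_disjoint_low s3 (subxx low))); rewrite inE.
have hU : nhol (S :\ s :|: anti s) = #|S :\ s|.
  apply: eq_card => i; rewrite [LHS]in_set in_setU.
  case iA: (i \in S :\ s) => /=; first exact: lowA.
  by case iV: (i \in anti s) => //=; exact: lowV.
have aU : nanti (S :\ s :|: anti s) = 2.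
  rewrite -[RHS](card_anti s3); apply: eq_card => i; rewrite [LHS]in_set in_setU leqNgt.
  case iV: (i \in anti s); first by rewrite orbT lowV.
  by case iA: (i \in S :\ s) => //=; rewrite lowA.
have := mw (S :\ s :|: anti s) g.
rewrite /mubar /Defs.proj hU aU !eqxx /= -cS (cardsD1 s S) sS eqxx.
have [c c0 ->] := dform_anti g tw s3 Al sA.
by rewrite setD1K // => /eqP; rewrite mulf_eq0 (negPf c0) orbF => /eqP.
Qed.

End Coefficients.

(** * The equation [dbar psi = 0] for multiples of [Phi^1] *)

Section Holomorphic.
Variable R : realType.
Implicit Types (w : Defs.form R) (f : 'rV[R]_6 -> R[i]) (U S : {set 'I_6}) (g : 'rV[R]_6).

Lemma dbasis_Phi0 U g : @dbasis R [set o6 0] U g = 0.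
Proof.
rewrite /dbasis big_set1 wedge_basis; case: ifP; rewrite ?mulr0 // => _.
have -> V : @dtheta R (o6 0) V g = 0.
  by rewrite /dtheta val_o6 //= /fadd /fscale /fzero mulr0 addr0.
by rewrite !mulr0.
Qed.

Lemma dform_Phi0_multiple w U g : (forall S, S != [set o6 0] -> w S = fun=> 0) ->
  dform w U g = wedge (dfun (w [set o6 0])) (@Defs.basis R [set o6 0]) U g.
Proof.
move=> w0; rewrite /dform (bigD1 [set o6 0]) //= big1 ?addr0.
  by rewrite dbasis_Phi0 mulr0 addr0.
by move=> S nS; rewrite (w0 _ nS) wedge_basis dfun_cst mul0r mulr0 if_same addr0.
Qed.

(** As [d Phi^1 = 0], the component of [dbar (f Phi^1)] on [Phi^1] and a conjugate form is, up to
    sign, the component of [df] on that conjugate form. *)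
Lemma dbar_Phi0_multiple w (j : nat) g : (3 <= j < 6)%N ->
  (forall S, S != [set o6 0] -> w S = fun=> 0) -> form_eq0 (dbar 1 0 w) ->
  dfun (w [set o6 0]) [set o6 j] g = 0.
Proof.
move=> /andP[j3 j6] w0 dw.
have n0j : o6 0 != o6 j.
  by rewrite -(inj_eq val_inj) /= !val_o6 // ltn_eqF // (leq_trans _ j3).
have hU : nhol [set o6 0; o6 j] = 1%N.
  apply/eqP/cards1P; exists (o6 0); apply/setP => i; rewrite !inE andb_orl.
  case: (eqVneq i (o6 0)) => [->|_]; first by rewrite val_o6.
  by case: eqP => // ->; rewrite val_o6 // ltnNge j3.
have aU : nanti [set o6 0; o6 j] = 1%N.
  apply/eqP/cards1P; exists (o6 j); apply/setP => i; rewrite !inE.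
  case: (eqVneq i (o6 j)) => [->|_]; first by rewrite val_o6 // j3 orbT.
  by case: eqP => //= ->; rewrite val_o6.
have := dw [set o6 0; o6 j] g; rewrite /dbar /Defs.proj hU aU /= dform_Phi0_multiple //.
rewrite wedge_basis sub1set !inE eqxx /=.
have -> : [set o6 0; o6 j] :\: [set o6 0] = [set o6 j].
  by rewrite setU1K // inE.
move/eqP; rewrite mulf_eq0 (negPf (wsign_neq0 _ _)) /= => [/eqP//|].
by rewrite disjoints1 inE eq_sym.
Qed.

Lemma sum_o6 (F : 'I_6 -> R[i]) :
  \sum_(i < 6) F i = F (o6 0) + F (o6 1) + F (o6 2) + F (o6 3) + F (o6 4) + F (o6 5).
Proof.
transitivity (\sum_(i < 6) F (o6 i)); first by apply: eq_bigr => i _; rewrite /o6 inord_val.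
by rewrite -(big_mkord xpredT (fun n => F (o6 n))) !big_nat_recr //= big_geq // add0r.
Qed.

Local Notation u f := (fun g => complex.Re (f g)).
Local Notation v f := (fun g => complex.Im (f g)).

(** Here and in the next two lemmas the component of [df] is the derivative of [f] along the
    conjugate of a dual frame vector, starting with [conj Z_1 = (d_t + i d_x) / 2]. *)
Lemma dfun_o6_3 f g : dfun f [set o6 3] g =
  pd (o6 0) f g * Complex 2^-1 0 + pd (o6 1) f g * Complex 0 2^-1.
Proof.
rewrite /dfun sum_o6 /dcoord /= !val_o6 //= !ef_antiholomorphic ?val_o6 //=.
by do !move: (pd _ f g) => ?; ring.
Qed.

Lemma dfun_o6_4 f g : dfun f [set o6 4] g =
  pd (o6 2) f g * (rC (expR (crd g 0)) * Complex 2^-1 0) +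
  pd (o6 3) f g * (rC (expR (- crd g 0)) * Complex 0 2^-1).
Proof.
rewrite /dfun sum_o6 /dcoord /= !val_o6 //= !ef_antiholomorphic ?val_o6 //=.
by do !move: (pd _ f g) => ?; ring.
Qed.

(** The multiple of [conj Z_2] comes from the terms [x e^t e^5] of [dy_1] and [x e^-t e^6] of
    [dy_2]. *)
Lemma dfun_o6_5 f g : dfun f [set o6 5] g =
  rC (crd g 1) * dfun f [set o6 4] g +
  (pd (o6 4) f g * (rC (expR (crd g 0)) * Complex 2^-1 0) +
   pd (o6 5) f g * (rC (expR (- crd g 0)) * Complex 0 2^-1)).
Proof.
have rCM (x y : R) : rC (x * y) = rC x * rC y by rewrite /rC; simpc.
rewrite dfun_o6_4 /dfun sum_o6 /dcoord /= !val_o6 //= !ef_antiholomorphic ?val_o6 //= !rCM.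
by do !move: (pd _ f g) => ?; ring.
Qed.

Lemma dfun3_eq0 f g : dfun f [set o6 3] g = 0 ->
  pdR (o6 0) (u f) g = pdR (o6 1) (v f) g /\ pdR (o6 0) (v f) g = - pdR (o6 1) (u f) g.
Proof.
rewrite dfun_o6_3 /pd.
move: (pdR _ (u f) g) (pdR _ (v f) g) (pdR _ (u f) g) (pdR _ (v f) g) => a b a' b'.
by simpc => -[h1 h2]; split; lra.
Qed.

Lemma expR_solve (t a b : R) : expR t * a - expR (- t) * b = 0 -> b = expR (2 * t) * a.
Proof.
move=> h; have E : expR t * expR (- t) = 1 by rewrite -expRD subrr expR0.
have -> : expR (2 * t) = expR t * expR t by rewrite -expRD; congr expR; ring.
have -> : b = expR t * expR (- t) * b by rewrite E mul1r.
by rewrite -!mulrA; congr (_ * _); apply/esym/eqP; rewrite -subr_eq0 h.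
Qed.

(** Real and imaginary parts, multiplied by [e^t], take the form with the single factor [e^(2t)]
    used by [pdR_eq0_of_bracket]. *)
Lemma complex_solve (t a b a' b' : R) :
  Complex a b * (rC (expR t) * Complex 2^-1 0) +
  Complex a' b' * (rC (expR (- t)) * Complex 0 2^-1) = 0 ->
  b' = expR (2 * t) * a /\ a' = - (expR (2 * t) * b).
Proof.
rewrite /rC; simpc => -[h1 h2]; split; first by apply: expR_solve; lra.
by rewrite -[a']opprK; congr (- _); apply: expR_solve; lra.
Qed.

Lemma dfun4_eq0 f g : dfun f [set o6 4] g = 0 ->
  pdR (o6 3) (v f) g = expR (2 * crd g 0) * pdR (o6 2) (u f) g /\
  pdR (o6 3) (u f) g = - (expR (2 * crd g 0) * pdR (o6 2) (v f) g).
Proof. by rewrite dfun_o6_4; exact: complex_solve. Qed.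

Lemma dfun5_eq0 f g : dfun f [set o6 4] g = 0 -> dfun f [set o6 5] g = 0 ->
  pdR (o6 5) (v f) g = expR (2 * crd g 0) * pdR (o6 4) (u f) g /\
  pdR (o6 5) (u f) g = - (expR (2 * crd g 0) * pdR (o6 4) (v f) g).
Proof. by rewrite dfun_o6_5 => ->; rewrite mulr0 add0r; exact: complex_solve. Qed.

End Holomorphic.

Theorem mainTheorem8 (R : realType) (a0 : R) (B : 'M[int]_2) (P : 'M[R]_2) :
  0 < a0 ->
  \det B = 1 ->
  P \in unitmx ->
  P *m map_mx (fun z : int => z%:~R) B *m invmx P
    = diag_mx (\row_(i < 2) nth 0 [:: expR a0; expR (- a0)] i) ->
  (* h^{1,0} = 1, spanned by Phi^1 *)
  (HDol_p0 a0 P 1 (@Phi R 0) /\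
   forall psi, HDol_p0 a0 P 1 psi ->
     exists c : R[i], forall U g, psi U g = c * @Phi R 0 U g) /\
  (* h^{2,0} = 0 *)
  (forall psi, HDol_p0 a0 P 2 psi -> form_eq0 psi) /\
  (* h^{3,0} = 0 *)
  (forall psi, HDol_p0 a0 P 3 psi -> form_eq0 psi).
Proof.
move=> a0_gt0 _ _ _.
have PhiE : @Phi R 0 = @Defs.basis R [set o6 0] by [].
have is_type_Phi : is_type 1 0 (@Phi R 0).
  move=> U g; rewrite PhiE /Defs.basis; case: (eqVneq U [set o6 0]) => [->|//] /negP[].
  rewrite /nhol /nanti; apply/andP; split.
    apply/cards1P; exists (o6 0); apply/setP => i; rewrite !inE.
    by case: eqP => // ->; rewrite val_o6.
  rewrite cards_eq0; apply/eqP/setP => i; rewrite !inE.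
  by case: eqP => // ->; rewrite val_o6.
have Phi_off S : S != [set o6 0] -> @Phi R 0 S = fun=> 0.
  by move=> nS; apply/funext => g; rewrite PhiE /Defs.basis (negPf nS).
have dPhi U g : dform (@Phi R 0) U g = 0.
  rewrite dform_Phi0_multiple // wedge_basis; case: ifP => // _.
  have -> : @Phi R 0 [set o6 0] = fun=> 1.
    by apply/funext => x; rewrite PhiE /Defs.basis eqxx.
  by rewrite dfun_cst mulr0.
have smooth_cst (c : R) : smoothR (fun _ : 'rV[R]_6 => c).
  have E l : exists d : R, foldr (@pdR R) (fun _ : 'rV[R]_6 => c) l = fun=> d.
    elim: l => [|k l [d IH]] /=; first by exists c.
    by exists 0; rewrite IH; apply/funext => g; exact: derive_cst.
  by move=> l; have [d ->] := E l; split=> [|k g]; [exact: cst_continuous|exact: derivable_cst].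
have lt1 : (0 < o6 1 < 3)%N by rewrite val_o6.
have lt2 : (0 < o6 2 < 3)%N by rewrite val_o6.
(* [mubar] kills the index sets containing 1 or 2. A remaining set of type (p,0) lies in
   [[set o6 0]] and is nonempty because [p > 0]. *)
have off p psi S : HDol_p0 a0 P p psi -> S != [set o6 0] -> (0 < p)%N -> psi S = fun=> 0.
  move=> [_ tp _ mp] nS p0; apply/funext => g.
  have [sS|ns1] := boolP (o6 1 \in S); first exact: (mubar_eq0 g tp mp lt1 sS).
  have [sS|ns2] := boolP (o6 2 \in S); first exact: (mubar_eq0 g tp mp lt2 sS).
  have [Sl|/(is_type_low tp) ->//] := boolP (S \subset low).
  apply: tp; apply: contra nS => /andP[/eqP hp _].
  have S0 : S \subset [set o6 0].
    apply/subsetP => i iS; have := subsetP Sl _ iS; rewrite !inE => i3.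
    have ni n : (n < 6)%N -> o6 n \notin S -> (nat_of_ord i == n) = false.
      by move=> n6; apply: contraNF => /eqP ein; rewrite /o6 -ein inord_val.
    have := ni 1%N isT ns1; have := ni 2%N isT ns2.
    rewrite -(inj_eq val_inj) /= val_o6 //.
    by case: (nat_of_ord i) i3 => [|[|[|]]].
  rewrite eqEcard S0 cards1; apply: leq_trans p0 _; rewrite -hp.
  by apply: subset_leq_card; apply/subsetP => i; rewrite inE => /andP[].
(* The one index set left by [off] has a single element, so its coefficient vanishes by type once
   [p > 1]. *)
have hp p psi : HDol_p0 a0 P p psi -> (1 < p)%N -> form_eq0 psi.
  move=> H p1 S g; have [->|nS] := eqVneq S [set o6 0]; last first.
    by rewrite (off _ _ _ H nS (ltnW p1)).
  have [_ tp _ _] := H; apply: tp; rewrite negb_and neq_ltn (leq_ltn_trans _ p1) //.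
  apply: (@leq_trans #|[set o6 0]|); last by rewrite cards1.
  apply: subset_leq_card; apply/subsetP => i.
  by rewrite !inE => /andP[].
split; last by split=> psi H; exact: (hp _ _ H).
split.
  split=> //.
  - move=> S; split=> [|gam g _]; last by [].
    by split; exact: smooth_cst.
  - by move=> U g; rewrite /dbar /Defs.proj dPhi if_same.
  - by move=> U g; rewrite /mubar /Defs.proj dPhi !if_same.
move=> psi H.
have po S : S != [set o6 0] -> psi S = fun=> 0 by move=> nS; exact: (off _ _ _ H nS).
have [sp _ dp _] := H; have [[su sv] inv] := sp [set o6 0].
pose f := psi [set o6 0].
have d3 g : dfun f [set o6 3] g = 0 by exact: dbar_Phi0_multiple.
have d4 g : dfun f [set o6 4] g = 0 by exact: dbar_Phi0_multiple.
have d5 g : dfun f [set o6 5] g = 0 by exact: dbar_Phi0_multiple.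
have kl (k l : 'I_6) : (k, l) \in [:: (o6 2, o6 3); (o6 4, o6 5)] -> forall g,
    pdR l (fun g => complex.Im (f g)) g =
      expR (2 * crd g 0) * pdR k (fun g => complex.Re (f g)) g /\
    pdR l (fun g => complex.Re (f g)) g =
      - (expR (2 * crd g 0) * pdR k (fun g => complex.Im (f g)) g).
  rewrite !inE !xpair_eqE => /orP[] /andP[/eqP-> /eqP->] g.
    exact: dfun4_eq0.
  exact: dfun5_eq0.
(* The real part is treated with [c = 1]; the imaginary part takes the first role with [c = -1]. *)
have fu := @invariant_holomorphic_constant R a0 1 P _ _ a0_gt0 (mulr1 1) su sv.
have fv := @invariant_holomorphic_constant R a0 (-1) P _ _ a0_gt0 _ sv su.
have Ef g : f g = f 0.
  apply/eqP; rewrite eq_complex; apply/andP; split; apply/eqP.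
    apply: fu.
    - by move=> gam x hg; rewrite inv.
    - by move=> x; rewrite mul1r; have [] := dfun3_eq0 (d3 x).
    - by move=> x; rewrite mulN1r; have [] := dfun3_eq0 (d3 x).
    - by move=> k l /kl h x; rewrite mul1r mulN1r; exact: h.
  apply: fv.
  - by rewrite mulrNN mulr1.
  - by move=> gam x hg; rewrite inv.
  - by move=> x; rewrite mulN1r; have [] := dfun3_eq0 (d3 x).
  - by move=> x; rewrite opprK mul1r; have [] := dfun3_eq0 (d3 x).
  - by move=> k l /kl h x; rewrite opprK mul1r mulN1r; have [] := h x.
exists (f 0) => U g; have [->|nU] := eqVneq U [set o6 0].
  by rewrite PhiE /Defs.basis eqxx mulr1; exact: Ef.
by rewrite (po _ nU) (Phi_off _ nU) mulr0.
Qed.
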